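(* A finite group $G$ is solvable if and only if every $8$ conjugate elements of $G$ generate a solvable subgroup (i.e. for every $g\in G$ and every $b_1,\dots,b_8\in G$, the subgroup $\langle b_1gb_1^{-1},\dots,b_8gb_8^{-1}\rangle$ is solvable). *)

(* Defs.v *)
From mathcomp Require Import all_boot all_fingroup all_solvable.

(* Main.v *)
Require Import Defs.
From mathcomp Require Import all_boot all_fingroup all_solvable.
From mathcomp Require Import zify.
Set Implicit Arguments.
Unset Strict Implicit.
Unset Printing Implicit Defensive.
Local Open Scope group_scope.

(* Factoring out solvable normal subgroups reduces the theorem to the
   following: if [x] has odd prime order and any eight conjugates of [x]
   generate a solvable group, then some nontrivial [r]-subgroup is normal. The
   key fact is that in a solvable group generated by a normal set of elements
   of odd prime order, some four of these elements generate a subgroup of the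
   same Fitting height. Hence, if [h] is the largest Fitting height of a
   subgroup [K] generated by four conjugates of [x], the group generated by
   [K] and [K :^ y], needing eight conjugates, has Fitting height [h] as well.
   So the last nontrivial iterated nilpotent residuals [W] of [K] and [W :^ y]
   of [K :^ y] generate a nilpotent group for all [y], and Baer-Suzuki applies
   to the elements of [W].

   The key fact rests on a bound for an element [x] of odd prime order of a
   solvable group [M] acting faithfully and irreducibly on [V]: if [x] and its
   conjugates generate [M] then [#|'C_V[x]| ^ 3 <= #|V| ^ 2].  If some abelian
   normal subgroup of [M] has nontrivial elements with fixed points on [V], then
   [V] is a direct product of subgroups permuted transitively by [M], at least
   half of which are moved by [x]; otherwise one intersects the centralizers of
   a few conjugates of [x]. *)

(** * Iterated nilpotent residuals *)

(* For [#|G| <= n], ['L_n.+1(G)] is the nilpotent residual of [G], so that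
   [nres n k G] is trivial iff [G] has Fitting height at most [k]. *)
Fixpoint nres n k (gT : finGroupType) (G : {group gT}) : {group gT} :=
  if k is k'.+1 then 'L_n.+1(nres n k' G)%G else G.

Section Residual.
Variable n : nat.
Implicit Types gT rT : finGroupType.

Lemma nres_char k gT (G : {group gT}) : nres n k G \char G.
Proof.
elim: k => [|k IH] /=; first exact: char_refl.
exact: char_trans (lcn_char _ _) IH.
Qed.

Lemma nres_sub k gT (G : {group gT}) : nres n k G \subset G.
Proof. exact: char_sub (nres_char k G). Qed.

Lemma nres_normal k gT (G : {group gT}) : nres n k G <| G.
Proof. exact: char_normal (nres_char k G). Qed.

Lemma nresS k gT (H G : {group gT}) : H \subset G -> nres n k H \subset nres n k G.
Proof. by move=> sHG; elim: k => //= k IH; apply: lcnS. Qed.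

Lemma morphim_nres k gT rT (D G : {group gT}) (f : {morphism D >-> rT}) :
  G \subset D -> f @* nres n k G = nres n k (f @* G)%G.
Proof.
move=> sGD; elim: k => //= k IH.
by rewrite morphim_lcn ?(subset_trans (nres_sub k G)) // IH.
Qed.

Lemma quotient_nres k gT (G N : {group gT}) :
  G \subset 'N(N) -> nres n k G / N = nres n k (G / N)%G.
Proof. exact: morphim_nres. Qed.

Lemma nresJ k gT (G : {group gT}) x : nres n k (G :^ x)%G = nres n k G :^ x :> {set gT}.
Proof.
have sJ (H : {group gT}) : conjgm_morphism G x @* (G :&: H) = (G :&: H) :^ x.
  by rewrite morphim_conj setIA setIid.
have := morphim_nres k (conjgm_morphism G x) (subxx G).
have /setIidPr eR := nres_sub k G.
rewrite -{1}eR sJ eR => ->.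
by congr (gval (nres _ _ _)); apply: val_inj => /=; rewrite morphim_conj setIid.
Qed.

Lemma nil_lcn1 gT (G : {group gT}) : nilpotent G -> #|G| <= n -> 'L_n.+1(G) = 1.
Proof.
move=> nilG leGn; apply/(lcn_nil_classP n nilG).
by rewrite (leq_trans _ leGn) // ltnW // -nilpotent_class.
Qed.

Lemma nres_nil k gT (G : {group gT}) : nres n k.+1 G :=: 1 -> nilpotent (nres n k G).
Proof. by move=> R1; apply/lcnP; exists n. Qed.

Lemma nres_eq1_nil k gT (G : {group gT}) :
  nilpotent (nres n k G) -> #|G| <= n -> nres n k.+1 G :=: 1.
Proof.
move=> nilR leG; apply: nil_lcn1 => //.
exact: leq_trans (subset_leq_card (nres_sub _ _)) leG.
Qed.

(** Until the residual is trivial, each step lowers its order: as [0 < n], the next residual lies in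
    the derived subgroup, which is proper by solvability. *)
Lemma nres_sol k gT (G : {group gT}) : 0 < n ->
  solvable G -> #|G| <= k -> nres n k G :=: 1.
Proof.
move=> n0 solG leGk.
suff: nres n k G :=: 1 \/ #|nres n k G| + k <= #|G|.
  case=> // le; have := leq_trans le leGk.
  by rewrite -[X in _ <= X]add0n leq_add2r leqNgt cardG_gt0.
elim: k {leGk} => [|k [R1|leR]]; first by right; rewrite addn0.
  by left; apply/trivgP; rewrite -R1 /= lcn_sub.
have [R1|nR1] := eqVneq (gval (nres n k G)) 1.
  by left; apply/trivgP; rewrite -R1 /= lcn_sub.
right; rewrite addnS -addSn; apply: leq_trans leR; rewrite leq_add2r.
apply: proper_card; apply: sub_proper_trans (sol_der1_proper solG (nres_sub k G) nR1).
by rewrite -lcn2 /= lcn_sub_leq.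
Qed.

(** The [k]-th residual of each normal closure is nilpotent once the next one is trivial; being
    normal in [L], it lies in ['F(L)], so induction applies to [L / 'F(L)]. *)
Lemma nres_gen_class k gT (L : {group gT}) (S : {set gT}) :
  #|L| <= n -> <<S>> = L -> (forall s, s \in S -> nres n k <<s ^: L>>%G :=: 1) ->
  nres n k L :=: 1.
Proof.
elim: k gT L S => [|k IH] gT L S leL defL R1 /=.
  apply/trivgP; rewrite -[gval L]defL gen_subG; apply/subsetP=> s Ss.
  have /trivgP/subsetP sR1 := R1 s Ss.
  by apply: sR1; rewrite /= mem_gen // class_refl.
have sSL: S \subset L by rewrite -defL subset_gen.
have nFL: L \subset 'N('F(L)) := gFnorm _ _.
suff /trivgP : nres n k (L / 'F(L))%G :=: 1.
  have nFR := subset_trans (nres_sub k L) nFL.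
  rewrite -(quotient_nres k nFL) quotient_sub1 // => sRF.
  apply: (@nres_eq1_nil k _ L) => //.
  exact: nilpotentS sRF (Fitting_nil L).
apply: (IH _ _ (S / 'F(L))).
- exact: leq_trans (leq_quotient _ _) leL.
- by rewrite /= -quotient_gen ?(subset_trans sSL) // defL.
move=> _ /morphimP[s Ns Ss ->].
have sL: s \in L by apply: (subsetP sSL).
have sclL: s ^: L \subset L by rewrite class_subG.
have sTL: <<s ^: L>>%G \subset L by rewrite gen_subG.
have ->: <<coset 'F(L) s ^: (L / 'F(L))>>%G = (<<s ^: L>> / 'F(L))%G.
  apply: val_inj; rewrite /= quotient_gen ?(subset_trans sclL) //.
  by congr <<_>>; rewrite /quotient morphim_class.
rewrite -quotient_nres ?(subset_trans sTL) //.
apply/trivgP; rewrite quotient_sub1; last first.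
  exact: subset_trans (nres_sub _ _) (subset_trans sTL nFL).
apply: Fitting_max; last exact: nres_nil (R1 s Ss).
apply: char_normal_trans (nres_char _ _) _.
by rewrite /normal sTL norms_gen // class_norm.
Qed.

End Residual.

(** * Centralizers in faithful irreducible modules *)

Lemma double_card_proper (gT : finGroupType) (H G : {group gT}) :
  H \proper G -> 2 * #|H| <= #|G|.
Proof.
case/andP=> sHG nsGH.
by rewrite -(Lagrange sHG) mulnC leq_mul2l indexg_gt1 nsGH orbT.
Qed.

(** For [Q] maximal, let [A] be a smallest normal subgroup of [M] not contained in [Q]. Then
    [M = A * Q] and [A :&: Q] is normal in [M]. Averaging over the cosets of [A] reduces the count
    to a centralizer in [A / (A :&: Q)]. *)
Lemma card_class_in_proper (gT : finGroupType) (M Q : {group gT}) x :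
  solvable M -> <<x ^: M>> = M -> Q \proper M ->
  2 * #|[set g in M | x ^ g \in Q]| <= #|M|.
Proof.
move=> solM genM ltQM.
wlog maxQ: Q ltQM / maximal Q M.
  move=> IH; have [eQM|[Q' maxQ' sQQ']] := maximal_exists (proper_sub ltQM).
    by rewrite eQM properxx in ltQM.
  apply: leq_trans (IH Q' (maxgroupp maxQ') maxQ').
  rewrite leq_mul2l /=; apply: subset_leq_card; apply/subsetP=> g.
  by rewrite !inE => /andP[-> /(subsetP sQQ')].
have [sQM nsMQ] := andP ltQM.
have xM: x \in M by rewrite -genM mem_gen ?class_refl.
pose P (A : {group gT}) := (A <| M) && ~~ (A \subset Q).
have PM: P M by rewrite /P normal_refl.
have [A /andP[nsAM nsAQ] minA] := arg_minnP (fun A : {group gT} => #|A|) PM.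
have [sAM nAM] := andP nsAM.
have sA'Q: A^`(1) \subset Q.
  apply/negPn/negP => nsA'Q.
  have: P A^`(1)%G by rewrite /P nsA'Q andbT; apply: char_normal_trans (der_char _ _) nsAM.
  move/minA; rewrite leqNgt => /negP[]; apply: proper_card.
  apply: (sol_der1_proper solM sAM); apply: contraNneq nsAQ => ->; exact: sub1G.
have defM: A * Q = M.
  rewrite -norm_joinEr ?(subset_trans sQM) //; apply/eqP.
  rewrite eqEproper join_subG sAM sQM /=; apply: contra nsAQ => ltAQ.
  have [_ /(_ (A <*> Q)%G ltAQ (joing_subr _ _))/= <-] := maxgroupP maxQ.
  exact: joing_subl.
have nsCM: A :&: Q <| M.
  rewrite /normal subIset ?sAM //= -{1}defM mul_subG //.
    rewrite -commg_subr (subset_trans (commgS _ (subsetIl _ _))) // subsetI.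
    by rewrite -derg1 der_sub sA'Q.
  by rewrite normsI ?normG // (subset_trans sQM).
have [sCM nCM] := andP nsCM.
have nCA := subset_trans sAM nCM.
(* If [y] and [y ^ a] are in [Q], then [[~ y, a]] is in [A :&: Q], so [a] lies in the group [B] of
   elements commuting with [y] modulo [A :&: Q]. Were [B] equal to [A], the conjugates of [y], hence
   [M], would centralize this quotient; [Q] would be normal and contain them all. *)
have half y: y \in x ^: M -> y \in Q -> 2 * #|[set a in A | y ^ a \in Q]| <= #|A|.
  move=> xMy Qy; have yM := subsetP sQM y Qy.
  pose B := (A :&: coset (A :&: Q) @*^-1 'C[coset (A :&: Q) y])%G.
  have sYB: [set a in A | y ^ a \in Q] \subset B.
    apply/subsetP=> a; rewrite inE => /andP[Aa Qya].
    have Na := subsetP nCA a Aa; have Ny := subsetP nCM y yM.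
    rewrite in_setI Aa /= mem_morphpre //; apply/cent1P.
    apply/commgP; rewrite -morphR //; apply/eqP/coset_id.
    rewrite in_setI; apply/andP; split.
      by rewrite commgEl groupM ?groupV // memJ_norm // (subsetP nAM).
    by rewrite commgEr conjVg groupM ?groupV.
  apply: leq_trans (_ : 2 * #|B| <= _); first by rewrite leq_mul2l subset_leq_card.
  apply: double_card_proper; rewrite properEneq subsetIl andbT.
  apply/eqP=> eBA.
  have sMcA: M / (A :&: Q) \subset 'C(A / (A :&: Q)).
    rewrite -(class_eqP xMy) in genM.
    rewrite -{1}genM quotient_gen ?(subset_trans _ nCM) ?class_subG //.
    rewrite gen_subG /quotient morphim_class ?(subsetP nCM) //.
    rewrite class_sub_norm ?norms_cent ?quotient_norms //.
    apply/centP=> _ /morphimP[a Na Aa ->]; apply/commute_sym/cent1P.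
    have: a \in gval B by rewrite eBA.
    by rewrite in_setI => /andP[_ /morphpreP[]].
  case/negP: nsMQ; rewrite quotient_cents2 // in sMcA.
  have nQM: M \subset 'N(Q).
    rewrite -{1}defM mul_subG ?normG // -commg_subr commGC.
    by rewrite (subset_trans (commSg _ sQM)) // (subset_trans sMcA) ?subsetIr.
  by rewrite -{1}genM gen_subG -(class_eqP xMy) class_sub_norm.
have halfc g: g \in M -> 2 * #|[set a in A | x ^ (g * a) \in Q]| <= #|A|.
  move=> Mg; set Y := [set a in A | _].
  have [-> | [b]] := set_0Vmem Y; first by rewrite cards0.
  rewrite inE => /andP[Ab Qb].
  suff ->: #|Y| = #|[set a in A | (x ^ (g * b)) ^ a \in Q]|.
    by apply: half => //; rewrite memJ_class // groupM // (subsetP sAM).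
  rewrite -(card_lcoset Y b^-1); apply: eq_card => a.
  rewrite mem_lcoset invgK !inE -conjgM mulgA; congr (_ && _).
  by rewrite groupMl.
set Gd := [set g in M | _].
suff: (#|A| * (2 * #|Gd|) <= #|A| * #|M|)%N by rewrite leq_pmul2l.
(* Double counting of pairs: for each fixed [a], replacing [g] by [g * a^-1] gives [#|Gd|] again. *)
have ->: (#|A| * (2 * #|Gd|) =
          2 * (\sum_(a in A) \sum_(g in M) ((x ^ (g * a))%g \in Q)))%N.
  rewrite mulnCA; congr (2 * _)%N.
  rewrite -sum_nat_const; apply: eq_bigr => a Aa.
  have Ma := subsetP sAM a Aa.
  rewrite (reindex_inj (mulIg a^-1)) /=.
  rewrite -sum1_card big_mkcond [RHS]big_mkcond; apply: eq_bigr => g _.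
  by rewrite inE mulgKV (groupMr g (groupVr Ma)); case: (g \in M); case: (_ \in Q).
rewrite exchange_big /= big_distrr /= mulnC -sum_nat_const.
apply: leq_sum => g Mg; apply: leq_trans (halfc g Mg).
rewrite leq_mul2l /= -sum1_card [X in X <= _]big_mkcond [X in _ <= X]big_mkcond /=.
by apply: leq_sum => a _; rewrite inE; case: (a \in A); case: (_ \in Q).
Qed.

(** Arithmetic for the Cauchy-Frobenius formula with [o] orbits of a group of order [p] on [n]
    points: [o * p <= n + (p - 1) * n / 2], and [(p + 1) / (2 * p) <= 2 / 3] for [p >= 3]. *)
Lemma orbit_count p n o f s t : 2 < p -> 2 * f <= n -> t <= n ->
  s <= p.-1 * f -> (t + s = o * p)%N -> 3 * o <= 2 * n.
Proof.
case: p => // p /= p2 h1 h2 h3 h4.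
suff : 3 * o * (2 * p.+1) <= 2 * n * (2 * p.+1) by rewrite leq_pmul2r.
have h5 : 2 * (p * f) <= p * n by rewrite mulnCA leq_mul2l h1 orbT.
have h6 : 2 * n <= p * n by rewrite leq_mul2r -ltnS p2 orbT.
by lia.
Qed.

(** * Fixed points of an element whose conjugates generate the group *)

Section CentralizerBound.

Variables (gT : finGroupType) (V M : {group gT}) (x : gT).
Hypotheses (abV : abelian V) (nVM : M \subset 'N(V)) (cMV1 : 'C_M(V) = 1).
Hypothesis irrV : forall U : {group gT},
  U \subset V -> M \subset 'N(U) -> U :=: 1 \/ U :=: V.
Hypotheses (solM : solvable M) (genM : <<x ^: M>> = M).

Lemma generator_mem : x \in M.
Proof. by rewrite -genM mem_gen ?class_refl. Qed.

Lemma card_subV (U1 U2 : {group gT}) : U1 \subset V -> U2 \subset V ->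
  #|U1| * #|U2| <= #|V| * #|U1 :&: U2|.
Proof.
by move=> sU1 sU2; rewrite mul_cardG leq_mul // subset_leq_card ?mul_subG.
Qed.

Lemma card_cent1J y g : g \in 'N(V) -> #|'C_V[y ^ g]| = #|'C_V[y]|.
Proof. by move=> Ng; rewrite -(cardJg 'C_V[y] g) conjIg (normP Ng) cent1J. Qed.

(** Points fixed by [y] and [y ^ g] are fixed by [[~ y, g]], and both fixed subgroups have the same
    order. *)
Lemma card_cent1_commg y g : g \in 'N(V) ->
  #|'C_V[y]| ^ 2 <= #|V| * #|'C_V[[~ y, g]]|.
Proof.
move=> Ng; rewrite -mulnn -{2}(card_cent1J y Ng).
apply: leq_trans (card_subV (subsetIl _ _) (subsetIl _ _)) _.
rewrite leq_mul2l subset_leq_card ?orbT //; apply/subsetP=> v.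
rewrite !in_setI => /andP[/andP[-> cvy] /andP[_ cvyg]].
by rewrite /= cent1C commgEl groupM ?groupV // cent1C.
Qed.

(** The fixed points of a central element are [M]-invariant, and they are not all of [V] by
    faithfulness. *)
Lemma cent1_central z : z \in 'Z(M) -> z != 1 -> 'C_V[z] = 1.
Proof.
case/setIP=> Mz cMz ntz.
have nCM: M \subset 'N('C_V[z]%G).
  by rewrite normsI // (subset_trans _ (normG _)) // sub_cent1.
have [//|eCV] := irrV (subsetIl V 'C[z]) nCM.
case/eqP: ntz; apply/set1P; rewrite -[[set 1]]cMV1 inE Mz /=.
by rewrite -sub_cent1 -eCV subsetIr.
Qed.

Lemma card_cent1_fpf g : g \in 'N(V) -> 'C_V[[~ x, g]] = 1 ->
  #|'C_V[x]| ^ 3 <= #|V| ^ 2.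
Proof.
move=> Ng C1; have := card_cent1_commg x Ng; rewrite C1 cards1 muln1 => le2.
apply: leq_trans (_ : #|'C_V[x]| ^ 4 <= _); first by rewrite leq_pexp2l ?cardG_gt0.
by rewrite (expnM _ 2 2) leq_sqr.
Qed.

Section Imprimitive.

Variables (B : {group gT}) (b0 : gT) (p : nat).
Hypotheses (abB : abelian B) (nsBM : B <| M).
Hypotheses (Bb0 : b0 \in B) (ntb0 : b0 != 1) (Cb0 : 'C_V[b0] != 1).
Hypotheses (pr_p : prime p) (p_gt2 : 2 < p) (ox : #[x] = p).

(* If [H0] is a largest subgroup of [B] having nontrivial fixed points on [V],
   then [V] is the direct product of the ['C_V(H)], [H] a conjugate of [H0]. *)
Lemma imprimitive_bound : #|'C_V[x]| ^ 3 <= #|V| ^ 2.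
Proof.
have [sBM nBM] := andP nsBM; have xM := generator_mem.
pose P (H : {group gT}) := (H \subset B) && ('C_V(H) != 1).
have Pb0: P <[b0]>%G by rewrite /P cycle_subG Bb0 cent_cycle.
have [H0 /andP[sH0B ntC0] maxH0] := arg_maxnP (fun H : {group gT} => #|H|) Pb0.
pose Om := orbit 'JG M H0.
have OmP H : H \in Om -> [/\ H \subset B, 'C_V(H) != 1, #|H| = #|H0|
                          & #|'C_V(H)| = #|'C_V(H0)|].
  case/orbitP=> g Mg <- /=.
  have eC: 'C_V(H0 :^ g) = 'C_V(H0) :^ g.
    by rewrite centJ conjIg (normsP nVM).
  by rewrite -{1}(normsP nBM g Mg) conjSg eC conjsg_eq1 !cardJg.
have fpf H b : H \in Om -> b \in B -> b \notin H -> 'C_V(H) :&: 'C[b] = 1.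
  move=> OH Bb nHb; have [sHB _ oH _] := OmP H OH.
  apply/eqP/negPn/negP => ntC.
  have: P (H <*> <[b]>)%G.
    by rewrite /P join_subG sHB cycle_subG Bb /= centY setIA cent_cycle.
  move/maxH0 => /=; rewrite -oH leqNgt => /negP[]; apply: proper_card.
  by rewrite properE joing_subl join_subG subxx cycle_subG.
pose W (S : {set {group gT}}) := <<\bigcup_(H in S) 'C_V(H)>>%G.
have sWV S : W S \subset V.
  by rewrite gen_subG; apply/bigcupsP=> H _; apply: subsetIl.
have W0 : W set0 :=: 1 by rewrite /= big_set0 gen0.
have cWW S T : W S \subset 'C(W T).
  exact: subset_trans (sWV S) (subset_trans abV (centS (sWV T))).
have WU S T : W (S :|: T) :=: W S * W T.
  by rewrite -cent_joinEr // /W /= bigcup_setU joing_idl joing_idr.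
have W1 H : W [set H] :=: 'C_V(H) by rewrite /= big_set1 genGid.
have nWB (S : {set {group gT}}) : S \subset Om -> B \subset 'N(W S).
  move=> /subsetP sSO; apply: norms_gen; apply/subsetP=> b Bb; rewrite inE.
  apply/subsetP=> _ /imsetP[v /bigcupP[H SH CHv] ->].
  apply/bigcupP; exists H => //.
  have [sHB _ _ _] := OmP H (sSO H SH).
  rewrite memJ_norm // (subsetP (normsI (subset_trans sBM nVM) _)) //.
  by rewrite (subset_trans _ (normG _)) // sub_abelian_cent.
(* Independence of the factors: for [b] in [H'] but not in [H], commutation with [b] kills the
   ['C_V(H')] component of [u], so [[~ u, b]] is trivial by induction, and [fpf] gives [u = 1]. *)
have TIW n (S : {set {group gT}}) H : #|S| < n -> S \subset Om -> H \in Om ->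
    H \notin S -> W S :&: 'C_V(H) = 1.
  elim: n S => // n IH S leSn sSO OH nSH.
  have [-> | [H' SH']] := set_0Vmem S; first by rewrite W0 (setIidPl (sub1G _)).
  have OH' := subsetP sSO H' SH'.
  have [sHB _ oH _] := OmP H OH; have [sHB' _ oH' _] := OmP H' OH'.
  have [b Hb' nHb]: exists2 b, b \in H' & b \notin H.
    apply/subsetPn; apply: contra nSH => sH'H.
    suff <-: H' = H by [].
    by apply/val_inj/eqP; rewrite /= eqEcard sH'H oH oH' leqnn.
  have Bb := subsetP sHB' b Hb'.
  pose S' := S :\ H'.
  have sSO' : S' \subset Om by apply: subset_trans sSO; apply: subsetDl.
  apply/trivgP/subsetP=> u /setIP[WSu CHu].
  suff Cbu : u \in 'C[b] by rewrite /= -[1%g](fpf H b OH Bb nHb) inE CHu.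
  suff: [~ u, b] \in W S' :&: 'C_V(H).
    rewrite (IH S') //; first by move/set1P/eqP/commgP=> cub; apply/cent1P/commute_sym.
      by move: leSn; rewrite [#|S|](cardsD1 H') SH'.
    by rewrite !inE negb_and nSH orbT.
  rewrite inE; apply/andP; split.
    move: WSu; rewrite -(setD1K SH') WU W1 => /mulsgP[v w /setIP[_ cv] WSw ->].
    have ->: [~ v * w, b] = [~ w, b].
      rewrite !commgEl conjMg [v ^ b](conjg_fixP _); last first.
        by apply/commgP; apply: (centP cv).
      by rewrite invMg -mulgA mulKg.
    by rewrite commgEl groupM ?groupV // memJ_norm // (subsetP (nWB S' sSO')).
  rewrite commgEl groupM ?groupV //.
  rewrite memJ_norm // (subsetP (normsI (subset_trans sBM nVM) _)) //.
  by rewrite (subset_trans _ (normG _)) // sub_abelian_cent.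
set c := #|'C_V(H0)|.
have c_gt0 : 0 < c by apply: cardG_gt0.
have cardW n (S : {set {group gT}}) : #|S| < n -> S \subset Om -> 
    #|W S| = (c ^ #|S|)%N.
  elim: n S => // n IH S leSn sSO.
  have [-> | [H SH]] := set_0Vmem S; first by rewrite W0 !cards0 cards1.
  have OH := subsetP sSO H SH; have [_ _ _ oCH] := OmP H OH.
  have sSO' : S :\ H \subset Om by apply: subset_trans sSO; apply: subsetDl.
  have leS' : #|S :\ H| < n by move: leSn; rewrite [#|S|](cardsD1 H) SH.
  rewrite -{1}(setD1K SH) WU TI_cardMg.
    by rewrite W1 oCH (IH (S :\ H)) // [#|S|](cardsD1 H) SH expnS.
  by rewrite W1 setIC (TIW n) // !inE eqxx.
have WS (S T : {set {group gT}}) : S \subset T -> W S \subset W T.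
  by move/setUidPr=> <-; rewrite WU mulG_subl.
have WI (S T : {set {group gT}}) : S \subset Om -> T \subset Om ->
    W S :&: W T = W (S :&: T).
  move=> sSO sTO; apply/esym/eqP.
  rewrite eqEcard subsetI !WS ?subsetIl ?subsetIr //=.
  have sUO : S :|: T \subset Om by rewrite subUset sSO.
  have sIO : S :&: T \subset Om by rewrite subIset ?sSO.
  rewrite -(leq_pmul2l (cardG_gt0 (W (S :|: T)))) WU -mul_cardG -WU.
  by rewrite !(cardW _ _ (ltnSn _)) // -!expnD cardsUI.
have WJ (S : {set {group gT}}) g : g \in M ->
    W S :^ g \subset W [set (H :^ g)%G | H : {group gT} in S].
  move=> Mg; rewrite /W /= -genJ genS //; apply/subsetP=> _ /imsetP[v + ->].
  case/bigcupP=> H SH CHv; apply/bigcupP; exists (H :^ g)%G.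
    by apply: imset_f.
  by rewrite /= centJ -{1}(normsP nVM g Mg) -conjIg memJ_conjg.
have WOm : W Om :=: V.
  have nWM : M \subset 'N(W Om).
    apply/subsetP=> g Mg; rewrite inE; apply: subset_trans (WJ Om g Mg) _.
    apply: WS; apply/subsetP=> _ /imsetP[H OH ->].
    by rewrite -(orbit_actr 'JG H0 H Mg) in OH.
  have [W1' | //] := irrV (sWV Om) nWM; case/negP: ntC0.
  have := WS [set H0] Om.
  by rewrite W1 W1' sub1set orbit_refl => /(_ isT)/trivgP->.
(* [x] fixes [H0 :^ g] exactly when [x ^ g^-1] lies in ['N_M(H0)]. This subgroup is proper:
   otherwise ['C_V(H0)] would be all of [V], against faithfulness. *)
have half : 2 * #|'Fix_(Om | 'JG)[x]| <= #|Om|.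
  set Fx := 'Fix_(Om | 'JG)[x].
  have eQ : 'C_M[H0 | 'JG] = 'N_M(H0) by rewrite astab1JG.
  have ltQ : 'N_M(H0) \proper M.
    rewrite properEneq subsetIl andbT; apply/eqP=> eNM.
    have nH0M : M \subset 'N(H0) by rewrite -eNM subsetIr.
    have nCM : M \subset 'N('C_V(H0)%G) by rewrite normsI ?norms_cent.
    have [C1|CV] := irrV (subsetIl V 'C(H0)) nCM; first by rewrite C1 eqxx in ntC0.
    have /subset_leq_card : H0 \subset 'C_M(V).
      by rewrite subsetI (subset_trans sH0B) // centsC -CV subsetIr.
    rewrite cMV1 cards1 leqNgt => /negP[].
    have /= := maxH0 _ Pb0; apply: leq_trans.
    by rewrite ltnNge -trivg_card_le1 cycle_eq1.
  have := card_class_in_proper solM genM ltQ.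
  rewrite -(card_orbit_stab 'JG M H0) eQ.
  set Y := [set g in M | _] => leY.
  suff oY : #|Y| = (#|Fx| * #|'N_M(H0)|)%N.
    by move: leY; rewrite oY mulnA leq_pmul2r ?cardG_gt0.
  have ->: #|Y| = #|[set g in M | (H0 :^ g)%G \in Fx]|.
    rewrite -(card_imset _ invg_inj); apply: eq_card => g.
    have ->: (g \in [set h^-1 | h in Y]) = (g^-1 \in Y).
      by rewrite -{1}(invgK g) (mem_imset _ _ invg_inj).
    rewrite [LHS]in_set [RHS]in_set groupV; case Mg: (g \in M) => //=.
    rewrite !in_setI (mem_orbit 'JG H0 Mg) /= groupJ ?groupV //=.
    apply/normP/afix1P => [|/(congr1 val)] /=.
      rewrite conjgE invgK !conjsgM => eH.
      by apply: val_inj => /=; rewrite -[in RHS]eH conjsgKV.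
    by move=> eH; rewrite conjgE invgK !conjsgM eH conjsgK.
  rewrite -sum1_card (partition_big (fun g => (H0 :^ g)%G) (mem Fx)) /=; last first.
    by move=> g; rewrite inE => /andP[].
  rewrite -sum_nat_const; apply: eq_bigr => H FH.
  have /orbitP[g Mg defH] : H \in Om by case/setIP: FH.
  rewrite -eQ -(card_rcoset _ g) -(amove_act 'JG H0 (subsetT M) Mg) -sum1_card.
  apply: eq_bigl => h; rewrite in_set [RHS]in_set -andbA defH; congr (_ && _).
  by apply: andb_idl => /eqP->.
have actsOm : [acts <[x]>, on Om | 'JG].
  apply: subset_trans (acts_orbit _ _ _); last exact: subsetT.
  by rewrite cycle_subG.
have [trX sXO _ exX] := orbit_transversalP actsOm.
set X := orbit_transversal _ _ _ in trX sXO exX.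
(* [X] has one point in each orbit of [<[x]>]. Every nontrivial element of [<[x]>] generates it, so
   has the same fixed points as [x]. *)
have oX3 : 3 * #|X| <= 2 * #|Om|.
  have := Frobenius_Cauchy actsOm; rewrite -(card_transversal trX) -orderE ox.
  rewrite (big_setD1 1) ?group1 //= => oXp.
  have le1 : #|'Fix_(Om | 'JG)[1]| <= #|Om| by rewrite subset_leq_card ?subsetIl.
  have le2 : \sum_(a in <[x]>^#) #|'Fix_(Om | 'JG)[a]| <= p.-1 * #|'Fix_(Om | 'JG)[x]|.
    have -> : p.-1 = #|<[x]>^#| by rewrite -ox orderE (cardsD1 1 <[x]>) group1.
    rewrite -sum_nat_const; apply: leq_sum => a /setD1P[nta xa].
    rewrite subset_leq_card // setIS //; apply/subsetP=> H /afix1P eH.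
    suff : x \in 'N(H) by move/normP=> eHx; apply/afix1P/val_inj.
    have sax : <[a]> = <[x]>.
      apply/eqP; rewrite eqEcard cycle_subG xa -!orderE ox.
      have dv : #[a] %| p by rewrite -ox order_dvdG.
      have /primeP[_ /(_ _ dv)/pred2P[/eqP|->]] := pr_p; last by rewrite leqnn.
      by rewrite order_eq1 (negPf nta).
    rewrite -cycle_subG -sax cycle_subG; apply/normP; exact: (congr1 val eH).
  exact: orbit_count p_gt2 half le1 le2 oXp.
set S' := Om :\: X.
have sSO : S' \subset Om by apply: subsetDl.
(* A smallest [T] in [S'] with [v] in [W T] is [x]-invariant because [x] fixes [v]. As [S'] omits a
   point of every orbit, [T] is empty. *)
have TI : 'C_V[x] :&: W S' = 1.
  apply/trivgP/subsetP=> v /setIP[/setIP[Vv cxv] WSv].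
  pose R (T : {set {group gT}}) := (T \subset S') && (v \in W T).
  have RS : R S' by rewrite /R subxx.
  have [T /andP[sTS WTv] minT] := arg_minnP (fun T : {set {group gT}} => #|T|) RS.
  pose Tx := [set (H :^ x)%G | H : {group gT} in T].
  have sTO := subset_trans sTS sSO.
  have sTxO : Tx \subset Om.
    apply/subsetP=> _ /imsetP[H TH ->].
    have OH := subsetP sTO H TH.
    by rewrite -(orbit_actr 'JG H0 H xM) in OH.
  have WTxv : v \in W Tx.
    have <- : v ^ x = v by apply/conjg_fixP/commgP/cent1P.
    by rewrite (subsetP (WJ T x xM)) // memJ_conjg.
  have eTx : T \subset Tx.
    have : R (T :&: Tx) by rewrite /R subIset ?sTS // -WI // inE WTv.
    move/minT => le; apply/setIidPl/eqP.
    by rewrite eqEcard subsetIl.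
  have eT : Tx = T.
    by apply/esym/eqP; rewrite eqEcard eTx leq_imset_card.
  have [T0 | [H TH]] := set_0Vmem T; first by rewrite T0 W0 in WTv.
  have [a xa Xa] := exX H (subsetP sTO H TH).
  have : 'JG%act H a \in T.
    case/cycleP: xa => i ->; elim: i => [|i IH]; first by rewrite act1.
    by rewrite expgSr actM -eT; apply: imset_f.
  by move/(subsetP sTS); rewrite inE Xa.
have := card_subV (subsetIl V 'C[x]) (sWV S').
have oV : #|V| = (c ^ #|Om|)%N by rewrite -WOm (cardW _ _ (ltnSn _)).
have oS : (#|S'| + #|X| = #|Om|)%N.
  by rewrite -(cardsID X Om) (setIidPr sXO) addnC.
rewrite TI cards1 muln1 (cardW _ _ (ltnSn _)) // oV -oS expnD mulnC.
rewrite leq_pmul2l ?expn_gt0 ?c_gt0 // => leC.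
apply: leq_trans (_ : (c ^ #|X|) ^ 3 <= _)%N; first by rewrite leq_exp2r.
rewrite -expnD -!expnM leq_pexp2l // mulnC.
by rewrite oS (leq_trans oX3) // mulnC.
Qed.
End Imprimitive.

(* A minimal noncentral normal subgroup [E] of [M] has class two, and its derived
   subgroup, being central in [M], acts without fixed points on [V]. *)
Section QuasiPrimitive.

Hypothesis cent_abelian : forall B : {group gT},
  abelian B -> B <| M -> B \subset 'Z(M).

Lemma quasiprimitive_noncommuting (E : {group gT}) :
  E <| M -> E^`(1) \subset 'Z(M) -> coprime #|E| #[x] ->
  (exists2 e, e \in E & [~ x, e] \notin 'Z(E)) ->
  exists2 e, e \in E & exists2 e', e' \in E & [~ [~ x, e], [~ x, e']] != 1.
Proof.
move=> nsEM sE'Z coEx [e0 Ee0 nZ]; have xM := generator_mem.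
have [sEM nEM] := andP nsEM.
have commxE e : e \in E -> [~ x, e] \in E.
  move=> Ee; rewrite commgEr groupM // memJ_norm ?groupV //.
  exact: (subsetP nEM).
pose Q := <<[set [~ x, e] | e in E]>>%G.
have Qx e : e \in E -> [~ x, e] \in Q by move=> Ee; apply/mem_gen/imset_f.
have [/exists_inP[e Ee /exists_inP[e' Ee' nz]] | /exists_inPn nE] :=
  boolP [exists e in E, exists e' in E, [~ [~ x, e], [~ x, e']] != 1].
  by exists e => //; exists e'.
case/negP: nZ; have abQ : Q \subset 'C(Q).
  rewrite -/(abelian _) abelian_gen; apply/centsP=> _ /imsetP[e Ee ->].
  move=> _ /imsetP[e' Ee' ->].
  have /exists_inPn/(_ e' Ee')/negPn := nE e Ee.
  by move/commgP.
have sQE : Q \subset E by rewrite gen_subG; apply/subsetP=> _ /imsetP[e Ee ->]; apply: commxE.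
have nQE : E \subset 'N(Q).
  apply/subsetP=> y Ey; rewrite inE -genJ gen_subG.
  apply/subsetP=> _ /imsetP[_ /imsetP[e Ee ->] ->].
  have -> : [~ x, e] ^ y = [~ x, y]^-1 * [~ x, e * y] by rewrite commgMJ mulKg.
  by rewrite groupM ?groupV ?Qx ?groupM.
have nQx : <[x]> \subset 'N(Q).
  rewrite cycle_subG inE -genJ gen_subG.
  apply/subsetP=> _ /imsetP[_ /imsetP[e Ee ->] ->].
  by rewrite conjRg {1}/conjg mulKg Qx // memJ_norm // (subsetP nEM).
have defE : E \subset Q * 'C_E(<[x]>).
  rewrite -quotientSK // coprime_quotient_cent // ?(solvableS sEM) //.
  rewrite subsetI subxx centsC quotient_cycle ?cycle_subG //; last by rewrite -cycle_subG.
  apply/centP=> _ /morphimP[e Ne Ee ->]; apply/commgP.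
  rewrite cycle_subG in nQx.
  by rewrite -morphR //; apply/eqP/coset_id/Qx.
have cQC : 'C_E(<[x]>) \subset 'C(Q).
  rewrite centsC gen_subG; apply/subsetP=> _ /imsetP[e Ee ->]; apply/centP=> c.
  rewrite cent_cycle => /setIP[Ec cxc]; apply/commgP/conjg_fixP; rewrite conjRg.
  have -> : x ^ c = x by apply/conjg_fixP/commgP/commute_sym/cent1P.
  have /setIP[Mw /centP cMw] : [~ e, c] \in 'Z(M).
    by apply: (subsetP sE'Z); rewrite derg1 mem_commg.
  rewrite conjg_mulR commgMJ.
  have -> : [~ x, [~ e, c]] = 1 by apply/eqP/commgP/commute_sym/cMw.
  rewrite mul1g; apply/conjg_fixP/commgP/commute_sym/cMw.
  exact: (subsetP sEM _ (commxE e Ee)).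
rewrite inE commxE //=; apply: (subsetP _ _ (Qx e0 Ee0)).
by rewrite centsC (subset_trans defE) // mul_subG.
Qed.

Lemma quasiprimitive_bound p :
  prime p -> 2 < p -> #[x] = p -> #|'C_V[x]| ^ 3 <= #|V| ^ 2.
Proof.
move=> pr_p p_gt2 ox; have xM := generator_mem.
have ntx : x != 1 by rewrite -order_eq1 ox neq_ltn prime_gt1 ?orbT.
have [sMZ | nsMZ] := boolP (M \subset 'Z(M)).
  by rewrite (cent1_central (subsetP sMZ x xM)) // cards1 exp1n expn_gt0 cardG_gt0.
pose P (A : {group gT}) := (A <| M) && ~~ (A \subset 'Z(M)).
have PM : P M by rewrite /P normal_refl.
have [E /andP[nsEM nsEZ] minE] := arg_minnP (fun A : {group gT} => #|A|) PM.
have [sEM nEM] := andP nsEM.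
have ltE (A : {group gT}) : A <| M -> A \proper E -> A \subset 'Z(M).
  move=> nsAM ltAE; apply/negPn/negP=> nsAZ.
  have /minE /= : P A by rewrite /P nsAM.
  by rewrite leqNgt (proper_card ltAE).
have ntE : E :!=: 1 by apply: contraNneq nsEZ => ->; apply: sub1G.
have sE'Z : E^`(1) \subset 'Z(M).
  apply: ltE; first exact: char_normal_trans (der_char _ _) nsEM.
  exact: sol_der1_proper solM sEM ntE.
have cE'E : E^`(1) \subset 'C(E).
  by rewrite (subset_trans sE'Z) // subIset // centS ?orbT.
have sZEZ : 'Z(E) \subset 'Z(M).
  apply: cent_abelian; first exact: center_abelian.
  exact: char_normal_trans (center_char _) nsEM.
have nVE := subset_trans sEM nVM.
have [cEx | ncEx] := boolP (x \in 'C(E)).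
  case/negP: nsEZ; rewrite subsetI sEM centsC -genM gen_subG class_sub_norm //.
  exact: norms_cent.
have [e0 Ee0 nce0] : exists2 e, e \in E & [~ x, e] != 1.
  apply/exists_inP; apply: contraNT ncEx => /exists_inPn cE.
  by apply/centP=> e Ee; apply/commgP/negPn/cE.
have fpf_comm u v : u \in E -> v \in E -> [~ u, v] != 1 -> 'C_V[[~ u, v]] = 1.
  move=> Eu Ev; apply: cent1_central; apply: (subsetP sE'Z).
  by rewrite derg1 mem_commg.
have commxE e : e \in E -> [~ x, e] \in E.
  move=> Ee; rewrite commgEr groupM // memJ_norm ?groupV //.
  exact: (subsetP nEM).
have [Zu | nZu] := boolP ([~ x, e0] \in 'Z(M)).
  by apply: card_cent1_fpf (subsetP nVE e0 Ee0) (cent1_central Zu nce0).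
(* In the coprime case, a common fixed point of [x], [x ^ e], [x ^ e'] is fixed by the commutator of
   [[~ x, e]] and [[~ x, e']], a nontrivial central element, so it is trivial. *)
have [coEx | ncoEx] := boolP (coprime #|E| p).
  have [e Ee [e' Ee' nz]] : exists2 e, e \in E & exists2 e', e' \in E &
      [~ [~ x, e], [~ x, e']] != 1.
    apply: quasiprimitive_noncommuting; rewrite ?ox //.
    by exists e0 => //; apply: contra nZu; apply: (subsetP sZEZ).
  have C1 := fpf_comm _ _ (commxE e Ee) (commxE e' Ee') nz.
  set C := 'C_V[x]; set C' := 'C_V[x ^ e]; set C'' := 'C_V[x ^ e'].
  have TI : (C :&: C') :&: C'' = 1.
    apply/trivgP; rewrite -C1; apply/subsetP=> v.
    rewrite !in_setI => /andP[/andP[/andP[-> cvx] /andP[_ cvxe]] /andP[_ cvxe']].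
    by rewrite /= cent1C groupR // commgEl groupM ?groupV // cent1C.
  have le1 := card_subV (subsetIl V 'C[x]) (subsetIl V 'C[x ^ e]).
  have le2 : #|C :&: C'| * #|C''| <= #|V|.
    have := @card_subV ('C_V[x] :&: 'C_V[x ^ e])%G 'C_V[x ^ e']%G.
    by rewrite subIset ?subsetIl // TI cards1 muln1; apply.
  rewrite -/C -/C' in le1.
  have oC' : #|C'| = #|C| by apply: card_cent1J (subsetP nVE e Ee).
  have oC'' : #|C''| = #|C| by apply: card_cent1J (subsetP nVE e' Ee').
  rewrite oC' in le1; rewrite oC'' in le2.
  rewrite (expnD _ 2 1) expn1 -mulnn (leq_trans (leq_mul le1 (leqnn _))) //.
  by rewrite -mulnA -mulnn leq_mul2l le2 orbT.
have nilE : nilpotent E.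
  by apply/lcnP; exists 2; apply/commG1P.
(* Both factors ['O_p(E)] and ['O_p^'(E)] are normal in [M]; if both were proper, they and hence [E]
   would be central. *)
have pE : p.-group E.
  have defE := nilpotent_pcoreC p nilE.
  have [sp sp'] : 'O_p(E) \subset E /\ 'O_p^'(E) \subset E by rewrite !pcore_sub.
  have nsO pi : 'O_pi(E) <| M by apply: char_normal_trans (pcore_char _ _) nsEM.
  have [eqp | ltp] := eqVproper sp; first by rewrite /pgroup -{1}eqp; apply: pcore_pgroup.
  have [eqp' | ltp'] := eqVproper sp'.
    case/negP: ncoEx; rewrite coprime_sym prime_coprime // -p'natE //.
    by have := pcore_pgroup p^' E; rewrite /pgroup eqp'.
  case/negP: nsEZ; have /dprodP[_ <- _ _] := defE.
  apply: mul_subG; first exact: ltE (nsO p) ltp.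
  exact: ltE (nsO p^') ltp'.
have [e Ee nz] : exists2 e, e \in E & [~ [~ x, e0], e] != 1.
  apply/exists_inP; apply: contraNT nZu => /exists_inPn cE.
  apply: (subsetP sZEZ); rewrite inE commxE //=; apply/centP=> e Ee.
  exact/commgP/negPn/cE.
set u := [~ x, e0] in nz *; set z := [~ u, e] in nz *.
have Eu : u \in E by apply: commxE.
have Zz : z \in 'Z(M) by apply: (subsetP sE'Z); rewrite derg1 mem_commg.
have Ez : z \in E by apply: groupR.
have [Mz /centP cMz] := setIP Zz.
have Cz1 := cent1_central Zz nz.
(* As a [p]-element, [z] has odd order, so [u], [u * z], [u * z ^+ 2] are three distinct conjugates
   of [u]. *)
have nz2 : z ^+ 2 != 1.
  rewrite -order_dvdn; apply: contra nz => dvz2; rewrite -order_eq1.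
  rewrite -dvdn1 -(eqP (_ : coprime 2 #[z])).
    by rewrite dvdn_gcd dvz2 dvdnn.
  apply: (pnat_coprime (pi := 2)) => //; apply: sub_in_pnat (mem_p_elt pE Ez).
  by move=> q _ /eqP->; rewrite !inE; move: p_gt2; case: (p) => [|[|[|]]].
have Cz2 := cent1_central (groupX 2 Zz) nz2.
have czE y : y \in E -> commute y z.
  by move=> Ey; apply: commute_sym; apply: cMz; apply: (subsetP sEM).
have cuz := czE u Eu.
have uJ : u ^ e = u * z by rewrite conjg_mulR.
have zJ : z ^ e = z by apply/conjg_fixP/commgP/commute_sym/czE.
have uJ2 : u ^ (e * e) = u * z ^+ 2 by rewrite conjgM uJ conjMg uJ zJ -mulgA.
clearbody z.
set C0 := 'C_V[u]%G; set C1 := 'C_V[u ^ e]%G; set C2 := 'C_V[u ^ (e * e)]%G.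
have oC1 : #|C1| = #|C0| by apply: card_cent1J (subsetP nVE e Ee).
have oC2 : #|C2| = #|C0|.
  by apply: card_cent1J (subsetP nVE _ (groupM Ee Ee)).
have TI01 : C0 :&: C1 = 1.
  apply/trivgP; rewrite -Cz1; apply/subsetP=> v.
  rewrite !in_setI uJ => /andP[/andP[-> cvu] /andP[_]].
  by rewrite /= cent1C groupMl 1?cent1C // cent1C.
have TI02 : C0 :&: C2 = 1.
  apply/trivgP; rewrite -Cz2; apply/subsetP=> v.
  rewrite !in_setI uJ2 => /andP[/andP[-> cvu] /andP[_]].
  by rewrite /= cent1C groupMl 1?cent1C // cent1C.
have NVz : z \in 'N(V) by apply: (subsetP nVE).
have Czu : z \in 'C[u] by apply/cent1P/commute_sym.
have Czu2 : z^-1 \in 'C[u * z ^+ 2].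
  rewrite groupV cent1C; apply: groupM; first by rewrite cent1C.
  exact: groupX (cent1id z).
(* On [C0], [C1], [C2] the element [u] acts as 1, [z^-1], [z ^- 2], as on distinct eigenspaces.
   Applying [u * z] to [v2 = v0 * v1] puts [v2^-1 * v2 ^ z^-1] in [C0 :&: C2], so [z] fixes [v2]. *)
have TI012 : (C0 <*> C1) :&: C2 = 1.
  apply/trivgP; rewrite -Cz1; apply/subsetP=> v2 /setIP[].
  rewrite /= cent_joinEr => [/mulsgP[v0 v1 Cv0 Cv1 def_v2] Cv2|]; last first.
    by rewrite subIset // (subset_trans abV) // centS ?subsetIl.
  have /setIP[Vv0 cv0] := Cv0; have /setIP[Vv1 cv1] := Cv1.
  have /setIP[Vv2 cv2] := Cv2.
  rewrite uJ in cv1; rewrite uJ2 in cv2.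
  have e1 : v0 ^ (u * z) = v0 ^ z.
    by rewrite conjgM [v0 ^ u](conjg_fixP (introT commgP (cent1P cv0))).
  have e2 : v1 ^ (u * z) = v1 by apply/conjg_fixP/commgP/cent1P.
  have e3 : v2 ^ (u * z) = v2 ^ z^-1.
    have {2}<- : v2 ^ (u * z ^+ 2) = v2 by apply/conjg_fixP/commgP/cent1P.
    by rewrite -conjgM expgS expg1 !mulgA mulgK.
  have e4 : v2^-1 * v2 ^ z^-1 = v0^-1 * v0 ^ z.
    rewrite -e3 def_v2 conjMg e1 e2 invMg -mulgA (mulgA v0^-1) -conjgE.
    apply/conjg_fixP/commgP; apply: (centsP abV) => //.
    by rewrite groupM ?groupV ?memJ_norm.
  have : v2^-1 * v2 ^ z^-1 \in C0 :&: C2.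
    rewrite in_setI {1}e4; apply/andP; split; apply: groupM; rewrite ?groupV //.
      by rewrite in_setI memJ_norm // Vv0 /= groupJ.
    by rewrite in_setI memJ_norm ?groupV // Vv2 /= uJ2 groupJ.
  rewrite TI02 => /set1P eq1; rewrite in_setI Vv2 /= cent1C -groupV cent1C.
  by apply/cent1P/commgP/eqP; rewrite commgEl.
have leV : #|C0| ^ 3 <= #|V|.
  have sC k : 'C_V[k] \subset V by apply: subsetIl.
  rewrite (expnD _ 2 1) expn1 -mulnn -{2}oC1 -{2}oC2 -TI_cardMg // -cent_joinEr.
    rewrite -TI_cardMg // subset_leq_card // mul_subG ?sC //.
    by rewrite join_subG !sC.
  exact: subset_trans (sC _) (subset_trans abV (centS (sC _))).
have := card_cent1_commg x (subsetP nVE e0 Ee0); rewrite -/u -/C0 => leC.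
rewrite -leq_sqr -!expnM.
apply: leq_trans (_ : (#|'C_V[x]| ^ 2) ^ 3 <= _)%N; first by rewrite -expnM.
apply: leq_trans (_ : (#|V| * #|C0|) ^ 3 <= _)%N; first by rewrite leq_exp2r.
by rewrite expnMn (expnD _ 3 1) leq_mul2l expn1 leV orbT.
Qed.

End QuasiPrimitive.

(** Besides the imprimitive and quasiprimitive cases, there may be a noncentral abelian normal [B]
    whose nontrivial elements fix no point. Then [x] does not centralize [B], as its conjugates
    generate [M], and some [[~ x, e]] in [B] is fixed-point-free. *)
Lemma card_cent1_bound p :
  prime p -> 2 < p -> #[x] = p -> #|'C_V[x]| ^ 3 <= #|V| ^ 2.
Proof.
move=> pr_p p_gt2 ox.
have xM := generator_mem.
have [/existsP[B /and3P[abB nsB]] | nB] := boolP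
  [exists B : {group gT}, [&& abelian B, B <| M & [exists b in B, (b != 1) && ('C_V[b] != 1)]]].
  by case/exists_inP=> b Bb /andP[ntb Cb]; exact: imprimitive_bound abB nsB Bb ntb Cb pr_p p_gt2 ox.
have fpf (B : {group gT}) b : abelian B -> B <| M -> b \in B -> b != 1 -> 'C_V[b] = 1.
  move=> abB nsB Bb ntb; apply/eqP; apply: contraNT nB => Cb.
  apply/existsP; exists B; rewrite abB nsB; apply/exists_inP; exists b => //.
  by rewrite ntb.
have [/existsP[B /and3P[abB nsB nsBZ]] | nB'] := boolP
  [exists B : {group gT}, [&& abelian B, B <| M & ~~ (B \subset 'Z(M))]]; last first.
  apply: quasiprimitive_bound ox => // B abB nsB; apply/negPn; apply: contra nB' => nZ.
  by apply/existsP; exists B; rewrite abB nsB.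
have [sBM nBM] := andP nsB.
have [e Be nz] : exists2 e, e \in B & [~ x, e] != 1.
  apply/exists_inP; apply: contraNT nsBZ => /exists_inPn cE.
  rewrite subsetI sBM centsC -genM gen_subG class_sub_norm ?norms_cent //.
  by apply/centP=> e Be; apply/commgP/negPn/cE.
apply: (card_cent1_fpf (subsetP nVM e (subsetP sBM e Be))).
apply: fpf abB nsB _ nz.
by rewrite commgEr groupM // memJ_norm ?groupV // (subsetP nBM).
Qed.

End CentralizerBound.

(** * Four generators achieve the Fitting height *)

Section UniqueMinimalNormal.

Variables (gT : finGroupType) (L V W : {group gT}) (q : nat).
Hypotheses (solL : solvable L) (nsVL : V <| L) (ntV : V :!=: 1).
Hypotheses (abV : abelian V) (qV : q.-group V).
Hypothesis minV : forall N : {group gT}, N <| L -> N :!=: 1 -> V \subset N.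
Hypotheses (nsWL : W <| L) (sVW : V \subset W).
Hypotheses (nilWV : nilpotent (W / V)) (nnilW : ~~ nilpotent W).

Lemma unique_min_irr (U : {group gT}) :
  U \subset V -> L \subset 'N(U) -> U :=: 1 \/ U :=: V.
Proof.
move=> sUV nUL; have [U1 | ntU] := eqVneq (gval U) 1; first by left.
right; apply/eqP; rewrite eqEsubset sUV minV //.
by rewrite /normal nUL (subset_trans sUV) ?normal_sub.
Qed.

(** Take [M = 'N_L(H)] for a Hall [q^']-subgroup [H] of [W]. Since [W / V] is nilpotent, [V * H] is
    normal in [L], and the Frattini argument gives [V * M = L]. Here [V :&: M = 'C_V(H)], which is
    trivial because [W] is not nilpotent. A complement [K] normalizes a Hall subgroup of [V * H],
    which is conjugate to [H] under [V]. *)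
Lemma unique_min_complement :
  exists M : {group gT}, [/\ V * M = L, V :&: M = 1
    & forall K : {group gT}, K \subset L -> V * K = L -> V :&: K = 1 ->
      exists2 w, w \in V & K \subset M :^ w].
Proof.
have [sVL nVL] := andP nsVL; have [sWL nWL] := andP nsWL.
have [H hallH] := Hall_exists q^' (solvableS sWL solL).
have [sHW q'H _] := and3P hallH.
have sHL := subset_trans sHW sWL.
have nVH := subset_trans sHL nVL.
have coVH : coprime #|V| #|H| by apply: pnat_coprime qV q'H.
have TIVH := coprime_TIg coVH.
pose J := (V <*> H)%G.
have defJ : J :=: V * H by rewrite /= norm_joinEr.
have sJW : J \subset W by rewrite join_subG sVW.
have nsJL : J <| L.
  rewrite /normal (subset_trans sJW) //=.
  have hallHV : q^'.-Hall(W / V) (H / V) by apply: quotient_pHall.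
  have nsHV : H / V <| L / V.
    rewrite (nilpotent_Hall_pcore nilWV hallHV) /=.
    exact: char_normal_trans (pcore_char _ _) (quotient_normal _ nsWL).
  have : L / V \subset 'N(J / V).
    by rewrite /= quotientYidl // normal_norm.
  have nsVJ : V <| J.
    by rewrite /normal joing_subl (subset_trans (subset_trans sJW sWL)).
  rewrite -(quotient_normG nsVJ) quotientSGK // (subset_trans _ (normG _)) //.
  exact: joing_subl.
have hallHJ : q^'.-Hall(J) H.
  by apply: pHall_subl sJW hallH; rewrite joing_subr.
have solJ := solvableS (normal_sub nsJL) solL.
pose M := 'N_L(H)%G.
have sML : M \subset L := subsetIl _ _.
have nHM : M \subset 'N(H) := subsetIr _ _.
have defL : V * M = L.
  have := Hall_Frattini_arg solJ nsJL hallHJ.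
  by rewrite defJ -mulgA (mulSGid (_ : H \subset M)) // subsetI sHL normG.
have CVH : 'C_V(H) = 1.
  have nCL : L \subset 'N('C_V(H)%G).
    rewrite -defL mul_subG //.
      exact: cents_norm (subset_trans abV (centS (subsetIl _ _))).
    exact: normsI (subset_trans sML nVL) (norms_cent nHM).
  have [//|CV] := unique_min_irr (subsetIl V 'C(H)) nCL.
  have cVH : V \subset 'C(H) by rewrite -CV subsetIr.
  have nsHJ : H <| J by rewrite /normal joing_subr join_subG normG cents_norm.
  have nsHL : H <| L.
    rewrite -(normal_Hall_pcore hallHJ nsHJ).
    exact: char_normal_trans (pcore_char _ _) nsJL.
  have [H1 | ntH] := eqVneq (gval H) 1.
    case/negP: nnilW; apply: (@pgroup_nil _ q).
    have : (#|W|`_q^' == 1)%N by rewrite -(card_Hall hallH) H1 cards1.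
    by rewrite partG_eq1 /pgroup pnatNK.
  case/negP: ntV; rewrite -subG1 -TIVH subsetI subxx.
  exact: minV.
have TIVM : V :&: M = 1.
  apply/trivgP; rewrite -CVH -(coprime_norm_cent nVH coVH).
  by rewrite !subsetI subsetIl /= setIA subsetIr.
exists M; split=> // K sKL defK TIVK.
have [sJL nJL] := andP nsJL.
have defKJ : V * (K :&: J) = J by rewrite group_modl ?joing_subl // defK (setIidPr sJL).
have TIVKJ : V :&: (K :&: J) = 1 by rewrite setIA TIVK (setIidPl (sub1G _)).
have hallKJ : q^'.-Hall(J) (K :&: J)%G.
  rewrite pHallE subsetIr -(card_Hall hallHJ) /=.
  rewrite -(eqn_pmul2l (cardG_gt0 V)) -(TI_cardMg TIVH) -defJ.
  by rewrite -(@TI_cardMg _ V (K :&: J)%G TIVKJ) defKJ.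
have [y Jy defy] := Hall_trans solJ hallKJ hallHJ.
have : y \in H * V by rewrite (normC nVH) -defJ.
case/mulsgP=> h v Hh Vv defyhv.
have defKH : K :&: J = H :^ v.
  by rewrite -[LHS]/(gval (K :&: J)%G) defy defyhv conjsgM conjGid.
exists v => //; rewrite /= conjIg conjGid ?(subsetP sVL) // subsetI sKL -normJ.
by rewrite -defKH normsI ?normG // (subset_trans sKL).
Qed.

Lemma unique_min_cent_compl (M : {group gT}) :
  V * M = L -> V :&: M = 1 -> 'C_M(V) = 1.
Proof.
move=> defL TI; have [sVL nVL] := andP nsVL.
have sML : M \subset L by rewrite -defL mulG_subr.
have nsC : 'C_M(V)%G <| L.
  rewrite /normal subIset ?sML //= -{1}defL mul_subG //.
    by apply: cents_norm; rewrite centsC subsetIr.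
  exact: normsI (normG _) (norms_cent (subset_trans sML nVL)).
apply/eqP; apply: contraNT ntV => ntC.
rewrite -subG1 -TI subsetI subxx (subset_trans (minV nsC ntC)) //.
exact: subsetIl.
Qed.

Lemma unique_min_cent : 'C_L(V) \subset V.
Proof.
have [M [defL TI _]] := unique_min_complement.
have := unique_min_cent_compl defL TI.
rewrite -defL => C1; rewrite -group_modl //.
by rewrite C1 mulg1.
Qed.

(** The center of the [q]-group ['O_q(L)] meets [V] nontrivially, so contains [V]; thus ['O_q(L)]
    centralizes [V]. *)
Lemma unique_min_pcore : 'O_q(L) = V.
Proof.
have [sVL nVL] := andP nsVL.
apply/eqP; rewrite eqEsubset pcore_max // andbT.
have sVO : V \subset 'O_q(L) by rewrite pcore_max.
apply: subset_trans unique_min_cent; rewrite subsetI pcore_sub centsC /=.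
have nsVO : V <| 'O_q(L)%G.
  by rewrite /normal sVO (subset_trans (pcore_sub _ _)).
have ntC := meet_center_nil (pgroup_nil (pcore_pgroup q L)) nsVO ntV.
have nC : L \subset 'N(V :&: 'Z('O_q(L)))%G.
  apply: normsI => //; apply: char_norm_trans (center_char _) _.
  exact: gFnorm.
have [C1 | CV] := unique_min_irr (subsetIl V _) nC; first by rewrite C1 eqxx in ntC.
by rewrite -{1}CV; apply: subset_trans (subsetIr _ _) (subsetIr _ _).
Qed.

End UniqueMinimalNormal.

(** If [w] serves for [v], then [[~ f i, v i * w^-1]] lies in [V :&: M = 1], so [v i] is in
    ['C_V[f i] :* w]. Thus [#|V|] sets of at most [#|V| ^ (8 / 3)] tuples would cover [#|V| ^ 4]
    tuples. With [t] elements this needs [1 + 2 * t / 3 < t], whence four. *)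
Lemma four_complement_count (gT : finGroupType) (V M : {group gT}) (f : 'I_4 -> gT) :
  V :!=: 1 -> M \subset 'N(V) -> V :&: M = 1 -> (forall i, f i \in M) ->
  (forall i, #|'C_V[f i]| ^ 3 <= #|V| ^ 2) ->
  ~ (forall v : 'I_4 -> gT, (forall i, v i \in V) ->
       exists2 w, w \in V & forall i, f i ^ v i \in M :^ w).
Proof.
move=> ntV nVM TI Mf bd cov.
pose F w := family (fun i => 'C_V[f i] :* w).
have covF (v : {ffun 'I_4 -> gT}) : v \in ffun_on V -> exists2 w, w \in V & v \in F w.
  move/ffun_onP=> Vv; have [w Vw Mv] := cov v Vv; exists w => //.
  apply/familyP=> i; rewrite mem_rcoset.
  have Vu : v i * w^-1 \in V by rewrite groupM ?groupV.
  have : [~ f i, v i * w^-1] \in V :&: M.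
    rewrite in_setI; apply/andP; split.
      by rewrite commgEr groupM // memJ_norm ?groupV // (subsetP nVM).
    by rewrite commgEl groupM ?groupV // conjgM -mem_conjg.
  by rewrite TI => /set1P/eqP/commgP cfv; rewrite in_setI Vu; apply/cent1P/commute_sym.
have oF w : #|F w| = (\prod_i #|'C_V[f i]|)%N.
  rewrite card_family foldrE big_map big_enum /=.
  by apply: eq_bigr => i _; rewrite card_rcoset.
have le4 : #|V| ^ 4 <= #|V| * \prod_i #|'C_V[f i]|.
  pose X := [set v : {ffun 'I_4 -> gT} | v \in ffun_on V].
  have <- : #|X| = (#|V| ^ 4)%N by rewrite cardsE card_ffun_on card_ord.
  rewrite -sum1_card.
  apply: leq_trans (_ : (\sum_(v in X) \sum_(w in V) (v \in F w) <= _))%N.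
    apply: leq_sum => v; rewrite inE => /covF[w Vw Fv].
    by rewrite (bigD1 w) //= Fv.
  rewrite exchange_big /= -sum_nat_const; apply: leq_sum => w _.
  rewrite -(oF w) -sum1_card [X in X <= _]big_mkcond [X in _ <= X]big_mkcond.
  by apply: leq_sum => v _; case: (v \in X); case: (v \in F w).
have : (\prod_i #|'C_V[f i]|) ^ 3 <= (#|V| ^ 2) ^ 4.
  have <- : (\prod_(i < 4) (#|V| ^ 2) = (#|V| ^ 2) ^ 4)%N.
    by rewrite prod_nat_const card_ord.
  have -> : ((\prod_i #|'C_V[f i]|) ^ 3 = \prod_i #|'C_V[f i]| ^ 3)%N.
    exact: (big_morph (expn^~ 3) (fun a b => expnMn a b 3) (exp1n 3)).
  exact: leq_prod.
apply/negP; rewrite -ltnNge -expnM.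
rewrite -(ltn_pmul2l (_ : 0 < #|V| ^ 3)%N) ?expn_gt0 ?cardG_gt0 // -expnD -expnMn.
apply: leq_trans (_ : #|V| ^ 12 <= _)%N; first by rewrite ltn_exp2l ?cardG_gt1.
by rewrite (expnM _ 4 3) leq_exp2r.
Qed.

(** * Detecting the Fitting height on four elements *)

Definition four_gen n k (gT : finGroupType) (S : {set gT}) :=
  exists2 f : 'I_4 -> gT, forall i, f i \in S
    & nres n k <<[set f i | i : 'I_4]>>%G :!=: 1.

Lemma four_genS n k (gT : finGroupType) (S T : {set gT}) :
  S \subset T -> four_gen n k S -> four_gen n k T.
Proof. by move=> /subsetP sST [f Sf ntf]; exists f => // i; apply: sST. Qed.

Lemma four_gen_quotient n k (gT : finGroupType) (N : {group gT}) (S : {set gT}) :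
  S \subset 'N(N) -> four_gen n k (S / N) ->
  exists2 f : 'I_4 -> gT, forall i, f i \in S
    & nres n k (<<[set f i | i : 'I_4]>> / N)%G :!=: 1.
Proof.
move=> nNS [fb Sfb ntf].
have /fin_all_exists2[f Sf deff] i : exists2 y, y \in S & coset N y = fb i.
  by have /morphimP[y Ny Sy ->] := Sfb i; exists y.
exists f => //; suff -> : (<<[set f i | i : 'I_4]>> / N)%G = <<[set fb i | i : 'I_4]>>%G by [].
have sfS : [set f i | i : 'I_4] \subset S by apply/subsetP=> _ /imsetP[i _ ->].
apply: val_inj; rewrite /= quotient_gen ?(subset_trans sfS) //; congr <<_>>.
rewrite /quotient morphimEsub ?(subset_trans sfS) // -imset_comp.
by apply: eq_imset => i /=.
Qed.

Lemma four_gen_dec n k (gT : finGroupType) (S : {set gT}) :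
  four_gen n k S \/ ~ four_gen n k S.
Proof.
pose b := [exists f : {ffun 'I_4 -> gT}, [forall i, f i \in S] &&
  (nres n k <<[set f i | i : 'I_4]>>%G != 1 :> {set gT})].
have [/existsP[f /andP[/forallP Sf ntf]] | /existsPn nf] := boolP b.
  by left; exists f.
right=> [[f Sf ntf]]; have := nf [ffun i => f i]; rewrite negb_and.
case/orP=> [/forallPn[i] | /negPn/eqP e1]; first by rewrite ffunE Sf.
case/eqP: ntf; rewrite -e1; congr (gval (nres _ _ _)); apply: val_inj.
by congr <<_>>; apply: eq_imset => i; rewrite ffunE.
Qed.

(* Four generators suffice because, in a minimal counterexample, all lifts of a
   four-element generating set of the quotient by the minimal normal subgroup [V]
   generate complements of [V]; these are conjugate under [V], and
   [card_cent1_bound] shows that there are more lifts than that allows. *)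
Lemma nres_four_gen n p (gT : finGroupType) (L : {group gT}) (S : {set gT}) k :
  prime p -> 2 < p -> 0 < n -> solvable L -> #|L| <= n -> <<S>> = L ->
  L \subset 'N(S) -> (forall s, s \in S -> s ^+ p = 1) ->
  nres n k L :!=: 1 -> four_gen n k S.
Proof.
move=> pr_p p_gt2 n_gt0; have [m] := ubnP #|L|.
elim: m gT L S k => // m IH gT L S k leLm solL leLn defL nSL Sp ntR.
have sSL : S \subset L by rewrite -defL subset_gen.
case: k ntR => [ntL | k ntR].
  have [s Ss nts] : exists2 s, s \in S & s != 1.
    apply/exists_inP; apply: contraNT ntL => /exists_inPn S1.
    rewrite /= -subG1 -defL gen_subG; apply/subsetP=> s Ss.
    by rewrite inE; apply/negPn/S1.
  exists (fun=> s) => //=; apply: contra nts => /eqP gen1.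
  have : s \in <<[set s | i : 'I_4]>> by apply/mem_gen/imsetP; exists ord0.
  by rewrite gen1 => /set1P->.
have [//|nG] := four_gen_dec n k.+1 S.
have sub1 (T : {group gT}) : T \proper L -> <<S :&: T>> = T -> nres n k.+1 T :=: 1.
  move=> ltT genT; have sTL := proper_sub ltT.
  apply/eqP/negPn/negP => ntT; case: nG.
  apply: four_genS (subsetIl S T) _; apply: (IH _ T) => //.
  - exact: leq_trans (proper_card ltT) leLm.
  - exact: solvableS sTL solL.
  - exact: leq_trans (subset_leq_card sTL) leLn.
  - by rewrite normsI ?normG // (subset_trans sTL).
  - by move=> s /setIP[Ss _]; apply: Sp.
have quo1 (N : {group gT}) : N <| L -> N :!=: 1 -> nres n k.+1 (L / N)%G :=: 1.
  move=> nsNL ntN; have [sNL nNL] := andP nsNL.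
  apply/eqP/negPn/negP => ntQ; case: nG.
  have /four_gen_quotient[|f Sf ntf] : four_gen n k.+1 (S / N).
  - apply: (IH _ (L / N)%G) => //.
    + exact: leq_trans (ltn_quotient ntN sNL) leLm.
    + exact: quotient_sol.
    + exact: leq_trans (leq_quotient _ _) leLn.
    + by rewrite /= -quotient_gen ?defL // (subset_trans sSL).
    + exact: quotient_norms.
    + move=> _ /morphimP[s Ns Ss ->]; by rewrite -morphX // Sp // morph1.
  - exact: subset_trans sSL nNL.
  exists f => //; apply: contraNneq ntf => R1.
  have nf : <<[set f i | i : 'I_4]>>%G \subset 'N(N).
    rewrite gen_subG; apply/subsetP=> _ /imsetP[i _ ->].
    exact: (subsetP nNL) (subsetP sSL _ (Sf i)).
  by rewrite -quotient_nres // R1 quotient1.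
(* If no single class in [S] generates [L], the normal closures of its elements are proper, have
   trivial residual by [sub1], and force that of [L] to be trivial. *)
wlog [s Ss defS] : S sSL nSL defL Sp nG sub1 / exists2 s, s \in S & S = s ^: L.
  move=> IHS; have [/existsP[s /andP[Ss /eqP gen_s]] | /existsPn ngen] :=
    boolP [exists s, (s \in S) && (<<s ^: L>> == L)].
    have scS : s ^: L \subset S by rewrite class_sub_norm.
    apply: (four_genS scS).
    apply: IHS => //; first exact: subset_trans scS sSL.
    - exact: class_norm.
    - by move=> t /(subsetP scS)/Sp.
    - by move/(four_genS scS).
    - move=> T ltT genT; apply: sub1 => //; apply/eqP.
      rewrite eqEsubset gen_subG subsetIr -{1}genT genS //.
      exact: setSI.
    - by exists s; rewrite ?class_refl.
  case/eqP: ntR; apply: (nres_gen_class leLn defL) => s Ss.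
  have sclL : s ^: L \subset L by rewrite class_subG // (subsetP sSL).
  apply: sub1.
    rewrite properEneq gen_subG sclL andbT.
    by have := ngen s; rewrite Ss.
  apply/eqP; rewrite eqEsubset gen_subG subsetIr genS // subsetI subset_gen.
  by rewrite class_sub_norm ?Ss.
have gen_cl t : t \in S -> t ^: L = S.
  by rewrite defS => /class_eqP.
pose V := nres n k.+1 L; pose W := nres n k L.
have minV (N : {group gT}) : N <| L -> N :!=: 1 -> V \subset N.
  move=> nsNL ntN; have [sNL nNL] := andP nsNL.
  rewrite -quotient_sub1 ?(subset_trans (nres_sub _ _ _)) //.
  by rewrite quotient_nres // (quo1 N).
have nsVL : V <| L := nres_normal _ _ _.
have nsWL : W <| L := nres_normal _ _ _.
have [sVL nVL] := andP nsVL.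
have abV : abelian V.
  apply/commG1P/eqP/negPn/negP => ntV'.
  have := sol_der1_proper solL sVL ntR.
  rewrite properE => /andP[_ /negP]; apply.
  apply: (minV V^`(1)%G) => //; exact: char_normal_trans (der_char _ _) nsVL.
pose q := pdiv #|V|.
have qV : q.-group V.
  have ntO : 'O_q(V) != 1.
    rewrite -cardG_gt1 (card_Hall (nilpotent_pcore_Hall q (abelian_nil abV))).
    by rewrite p_part_gt1 pi_pdiv cardG_gt1.
  apply: pgroupS (pcore_pgroup q V); apply: (minV 'O_q(V)%G) => //.
  exact: char_normal_trans (pcore_char _ _) nsVL.
have sVW : V \subset W by apply: lcn_sub.
have nWV := subset_trans (normal_sub nsWL) nVL.
have nilWV : nilpotent (W / V).
  apply/lcnP; exists n; rewrite /= -morphim_lcn //.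
  exact: trivg_quotient.
have nnilW : ~~ nilpotent W.
  by apply/negP => nilW; case/eqP: ntR; apply: nres_eq1_nil.
have [M [defVM TIVM conjM]] := unique_min_complement solL nsVL ntR abV qV minV nsWL sVW nilWV nnilW.
have CMV := unique_min_cent_compl nsVL ntR minV defVM TIVM.
have sCV := unique_min_cent solL nsVL ntR abV qV minV nsWL sVW nilWV nnilW.
have OqL := unique_min_pcore solL nsVL ntR abV qV minV nsWL sVW nilWV nnilW.
have irrV := unique_min_irr nsVL minV.
have sML : M \subset L by rewrite -defVM mulG_subr.
have nVM := subset_trans sML nVL.
have ntWV : nres n k (L / V)%G :!=: 1.
  rewrite -quotient_nres //; apply: contraNneq nnilW => /trivgP.
  by rewrite quotient_sub1 // => sWV; apply: abelian_nil; apply: abelianS abV.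
have [f Sf ntf] : exists2 f : 'I_4 -> gT, forall i, f i \in S
    & nres n k (<<[set f i | i : 'I_4]>> / V)%G :!=: 1.
  apply: four_gen_quotient; first exact: subset_trans sSL nVL.
  apply: (IH _ (L / V)%G) => //.
  - exact: leq_trans (ltn_quotient ntR sVL) leLm.
  - exact: quotient_sol.
  - exact: leq_trans (leq_quotient _ _) leLn.
  - by rewrite /= -quotient_gen ?defL // (subset_trans sSL).
  - exact: quotient_norms.
  - move=> _ /morphimP[t Nt St ->]; by rewrite -morphX // Sp // morph1.
have sub_gen (g : 'I_4 -> gT) (A : {set gT}) :
    (forall i, g i \in A) -> [set g i | i : 'I_4] \subset A.
  by move=> Ag; apply/subsetP=> _ /imsetP[i _ ->].
(* If [T] is proper, its [k]-th residual [N] is nilpotent, hence in ['F(J)]. This is a [q]-group: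
   its [q^']-part centralizes [V], so lies in [V]. Then [N / V] lies in ['O_q(L / V)], trivial as
   ['O_q(L) = V], against the choice of [f]. *)
have cover (g : 'I_4 -> gT) : (forall i, g i \in S) ->
    (forall i, coset V (g i) = coset V (f i)) -> V * <<[set g i | i : 'I_4]>> = L.
  move=> Sg eqg; pose K := <<[set g i | i : 'I_4]>>%G; rewrite -[<<_>>]/(gval K).
  have sKL : K \subset L by rewrite gen_subG sub_gen // => i; apply: (subsetP sSL).
  have sfL : [set f i | i : 'I_4] \subset L by rewrite sub_gen // => i; apply: (subsetP sSL).
  have nVK := subset_trans sKL nVL.
  pose J := (V <*> K)%G; have defJ : J :=: V * K by rewrite /= norm_joinEr.
  have sJL : J \subset L by rewrite join_subG sVL.
  have sKJ : K \subset J by apply: joing_subr.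
  have nsVJ : V <| J by apply: normalS nsVL; rewrite ?joing_subl.
  have eqK : (K / V)%G = (<<[set f i | i : 'I_4]>> / V)%G.
    apply: val_inj; rewrite /= !quotient_gen; last 2 first.
    - exact: subset_trans sfL nVL.
    - exact: subset_trans (subset_gen _) nVK.
    congr <<_>>; rewrite /quotient !morphimEsub -?imset_comp; last 2 first.
    - exact: subset_trans sfL nVL.
    - exact: subset_trans (subset_gen _) nVK.
    by apply: eq_imset => i /=; apply: eqg.
  pose T := [group of <<S :&: J>>].
  have sTJ : T \subset J by rewrite gen_subG subsetIr.
  have sKT : K \subset T.
    rewrite genS // sub_gen // => i; rewrite inE Sg (subsetP sKJ) //.
    exact/mem_gen/imset_f.
  have genT : <<S :&: T>> = T.
    apply/eqP; rewrite eqEsubset gen_subG subsetIr genS //.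
    by rewrite subsetI subsetIl subset_gen.
  have [eTL | neTL] := eqVneq (gval T) L.
    by apply/eqP; rewrite -defJ eqEsubset sJL -eTL.
  have ltT : T \proper L by rewrite properEneq neTL (subset_trans sTJ).
  have nilN := nres_nil (sub1 T ltT genT); set N := nres n k T in nilN.
  have nsTJ : T <| J.
    by rewrite /normal sTJ norms_gen // normsI ?normG // (subset_trans sJL).
  have nsNJ : N <| J := char_normal_trans (nres_char _ _ _) nsTJ.
  pose F := 'F(J)%G; have nilF : nilpotent F := Fitting_nil J.
  have sVF : V \subset F by apply: Fitting_max => //; apply: abelian_nil.
  have sNF : N \subset F by apply: Fitting_max.
  have sFL : F \subset L by apply: subset_trans sJL; apply: Fitting_sub.
  have hallq := nilpotent_pcore_Hall q nilF.
  have hallq' := nilpotent_pcore_Hall q^' nilF.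
  have sOV : 'O_q^'(F) \subset V.
    apply: subset_trans sCV; rewrite subsetI (subset_trans (pcore_sub _ _)) //.
    have /dprodP[_ _ cO _] := nilpotent_pcoreC q nilF.
    by apply: subset_trans cO (centS _); rewrite (sub_Hall_pcore hallq).
  have qF : q.-group F.
    have := pnat_1 (pgroupS sOV qV) (pcore_pgroup q^' F).
    by rewrite (card_Hall hallq') => /eqP; rewrite partG_eq1 /pgroup pnatNK.
  have sNW : N \subset W by apply: nresS; apply: subset_trans sTJ sJL.
  have N1 : N / V \subset 'O_q(L / V).
    apply: subset_trans (_ : 'O_q(W / V) \subset _).
      rewrite (sub_Hall_pcore (nilpotent_pcore_Hall q nilWV)) ?quotientS //.
      exact: quotient_pgroup (pgroupS sNF qF).
    apply: pcore_max (pcore_pgroup _ _) _.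
    exact: char_normal_trans (pcore_char _ _) (quotient_normal _ nsWL).
  have O1 : 'O_q(L / V) = 1 by rewrite (pquotient_pcore nsVL qV) OqL trivg_quotient.
  rewrite O1 in N1.
  case/eqP: ntf; rewrite -eqK; apply/trivgP; apply: subset_trans N1.
  rewrite quotient_nres ?(subset_trans sTJ) ?normal_norm //.
  by apply: nresS; apply: quotientS.
(* The intersection is normal in [L], so it is 1 or [V]; if it is [V], the four elements generate
   [L], against [nG]. *)
have TIgen (g : 'I_4 -> gT) : (forall i, g i \in S) ->
    V * <<[set g i | i : 'I_4]>> = L -> V :&: <<[set g i | i : 'I_4]>> = 1.
  move=> Sg defL'.
  have nI : L \subset 'N(V :&: <<[set g i | i : 'I_4]>>)%G.
    rewrite -defL' mul_subG //.
      exact: cents_norm (subset_trans abV (centS (subsetIl _ _))).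
    apply: normsI (normG _); apply: subset_trans nVL.
    by rewrite gen_subG sub_gen // => i; apply: (subsetP sSL).
  have [//|/setIidPl sVg] := irrV _ (subsetIl _ _) nI.
  case: nG; exists g => //; suff -> : <<[set g i | i : 'I_4]>>%G = L by [].
  by apply: val_inj; rewrite /= -[RHS]defL' mulSGid.
have conj_gen (g : 'I_4 -> gT) : (forall i, g i \in S) ->
    (forall i, coset V (g i) = coset V (f i)) ->
    exists2 w, w \in V & forall i, g i \in M :^ w.
  move=> Sg eqg; have defL' := cover g Sg eqg.
  have sKL : <<[set g i | i : 'I_4]>> \subset L by rewrite -defL' mulG_subr.
  have [w Vw sKM] := conjM _ sKL defL' (TIgen g Sg defL').
  by exists w => // i; apply: (subsetP sKM); apply/mem_gen/imset_f.
have SJ t y : t \in S -> y \in L -> t ^ y \in S.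
  by move=> St Ly; rewrite memJ_norm // (subsetP nSL).
have cosetJ t v : t \in L -> v \in V -> coset V (t ^ v) = coset V t.
  move=> Lt Vv; rewrite morphJ ?(subsetP nVL) ?(subsetP sVL v Vv) //.
  by rewrite /= (coset_id Vv) conjg1.
have [w0 Vw0 Mw0] := conj_gen f Sf (fun=> erefl).
(* Conjugation moves the lifts into [M] itself. All tuples [h i ^ v i] with [v i] in [V] lift the
   same cosets, so each lies in a conjugate of [M]. *)
pose h i := f i ^ w0^-1.
have Vw0V : w0^-1 \in V by rewrite groupV.
have Sh i : h i \in S by rewrite SJ // (subsetP sVL).
have Mh i : h i \in M by rewrite -mem_conjg.
case: (@four_complement_count _ V M h) => //.
  move=> i; have Lh := subsetP sSL _ (Sh i).
  have genMh : <<h i ^: M>> = M.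
    pose N := <<h i ^: M>>%G; rewrite -[<<_>>]/(gval N).
    have sNM : N \subset M by rewrite gen_subG class_subG.
    have sLVN : L \subset V <*> N.
      rewrite -defL -(gen_cl _ (Sh i)) gen_subG class_sub_norm.
        by rewrite (subsetP (joing_subr V N)) // mem_gen ?class_refl.
      rewrite -defVM mul_subG //.
        exact: subset_trans (joing_subl V N) (normG _).
      by apply: normsY => //; apply: norms_gen; apply: class_norm.
    have TIVN : V :&: N = 1 by apply/trivgP; rewrite -TIVM setIS.
    apply/eqP; rewrite eqEcard sNM -(leq_pmul2l (cardG_gt0 V)).
    rewrite -(TI_cardMg TIVM) -(TI_cardMg TIVN) defVM subset_leq_card //.
    by rewrite -norm_joinEr // (subset_trans sNM).
  have irrM (U : {group gT}) : U \subset V -> M \subset 'N(U) -> U :=: 1 \/ U :=: V.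
    move=> sUV nUM; apply: irrV => //; rewrite -defVM mul_subG //.
    exact: cents_norm (subset_trans abV (centS sUV)).
  apply: (card_cent1_bound abV nVM CMV irrM (solvableS sML solL) genMh pr_p p_gt2).
  have : #[h i] %| p by rewrite order_dvdn Sp.
  have /primeP[_ dvp /dvp/pred2P[|//]] := pr_p.
  move/eqP; rewrite order_eq1 => /eqP h1; case/eqP: ntR; apply/trivgP.
  apply: subset_trans sVL _; rewrite -defL -(gen_cl _ (Sh i)) gen_subG h1.
  by rewrite class1G.
move=> v Vv; apply: conj_gen => i; first by rewrite SJ // (subsetP sVL).
have LS t : t \in S -> t \in L by apply: (subsetP sSL).
by rewrite cosetJ ?LS // /h cosetJ ?LS.
Qed.

(** * Eight conjugates *)

(* If [k] is maximal such that some [K] generated by four conjugates of [x] has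
   nontrivial [k]-th residual [W], then [K] and [K :^ y] generate a group whose
   [k]-th residual is nilpotent and contains both [W] and [W :^ y]. *)
Lemma Fitting_neq1_conj8 (gT : finGroupType) (G : {group gT}) x p :
  prime p -> 2 < p -> #[x] = p -> x \in G ->
  (forall g : 'I_8 -> gT, (forall i, g i \in x ^: G) ->
     solvable <<[set g i | i : 'I_8]>>) ->
  exists r : nat, 'O_r(G) != 1.
Proof.
move=> pr_p p_gt2 ox Gx sol8; set S := x ^: G.
have sSG : S \subset G by rewrite class_subG.
pose n := #|gT|; have n_gt0 : 0 < n by apply/card_gt0P; exists x.
have leGn (H : {group gT}) : #|H| <= n by apply: max_card.
pose pair8 (f g : 'I_4 -> gT) (i : 'I_8) := 
  match split (i : 'I_(4 + 4)) with inl j => f j | inr j => g j end.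
have pair8S f g : (forall i, f i \in S) -> (forall i, g i \in S) -> forall i, pair8 f g i \in S.
  by move=> Sf Sg i; rewrite /pair8; case: split.
have pair8l f g j : f j \in [set pair8 f g i | i : 'I_8].
  apply/imsetP; exists (lshift 4 j) => //.
  by rewrite /pair8 (unsplitK (inl j : 'I_4 + 'I_4)).
have pair8r f g j : g j \in [set pair8 f g i | i : 'I_8].
  apply/imsetP; exists (rshift 4 j) => //.
  by rewrite /pair8 (unsplitK (inr j : 'I_4 + 'I_4)).
have four0 : four_gen n 0 S.
  exists (fun=> x) => [i|]; first exact: class_refl.
  apply/eqP=> /= gen1; have : x \in <<[set x | i : 'I_4]>>.
    by apply/mem_gen/imsetP; exists ord0.
  by rewrite gen1 => /set1P x1; move: p_gt2; rewrite -ox x1 order1.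
have nfour : ~ four_gen n n S.
  case=> f Sf /eqP[]; apply: nres_sol => //.
  apply: solvableS (sol8 _ (pair8S f f Sf Sf)); rewrite genS //.
  by apply/subsetP=> _ /imsetP[i _ ->].
(* [four_gen] holds at 0 and fails at [n], where residuals of solvable groups vanish, so it switches
   somewhere between. *)
have [k Pk nPk] : exists2 k, four_gen n k S & ~ four_gen n k.+1 S.
  suff descent m : ~ four_gen n m S ->
      exists2 k, four_gen n k S & ~ four_gen n k.+1 S by apply: descent nfour.
  elim: m => // m IH nm.
  by have [Pm | ] := four_gen_dec n m S; [exists m | exact: IH].
have [f Sf ntW] := Pk; pose K := <<[set f i | i : 'I_4]>>%G.
pose W := nres n k K; pose r := pdiv #|W|.
have W_gt1 : 1 < #|W| by rewrite cardG_gt1.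
have [w Ww ow] := Cauchy (pdiv_prime W_gt1) (pdiv_dvd _).
exists r; apply/trivgPn; exists w; last first.
  by rewrite -order_eq1 ow neq_ltn prime_gt1 ?orbT ?pdiv_prime.
have sKG : K \subset G.
  by rewrite gen_subG; apply/subsetP=> _ /imsetP[i _ ->]; apply: (subsetP sSG).
(* It remains to see that [w] and [w ^ y] generate an [r]-group: both are [r]-elements of the
   nilpotent group [nres n k L]. *)
apply: Baer_Suzuki => [|y Gy].
  by apply: (subsetP sKG); apply: (subsetP (nres_sub _ _ _) _ Ww).
have Sfy i : f i ^ y \in S by rewrite memJ_norm // (subsetP (class_norm _ _)).
pose L := <<[set pair8 f (fun i => f i ^ y) i | i : 'I_8]>>%G.
have S8 := pair8S f _ Sf Sfy.
have solL : solvable L := sol8 _ S8.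
have sLG : L \subset G.
  by rewrite gen_subG; apply/subsetP=> _ /imsetP[i _ ->]; apply: (subsetP sSG).
have nilR : nilpotent (nres n k L).
  apply: nres_nil; apply/eqP/negPn/negP => ntR; case: nPk.
  apply: four_genS (subsetIl S L) _.
  apply: (nres_four_gen pr_p p_gt2 n_gt0 solL (leGn _)) => //.
  - apply/eqP; rewrite eqEsubset gen_subG subsetIr gen_subG.
    apply/subsetP=> _ /imsetP[i _ ->]; apply: mem_gen.
    by rewrite inE S8 mem_gen // imset_f.
  - by rewrite normsI ?normG // (subset_trans sLG) // class_norm.
  - move=> _ /setIP[/imsetP[z Gz ->] _].
    by rewrite -conjXg -ox expg_order conj1g.
have sKL : K \subset L.
  by rewrite genS //; apply/subsetP=> _ /imsetP[i _ ->]; apply: pair8l.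
have sKyL : (K :^ y)%G \subset L.
  rewrite /= -genJ gen_subG; apply/subsetP=> _ /imsetP[_ /imsetP[i _ ->] ->].
  exact/mem_gen/(pair8r f (fun i => f i ^ y)).
have hallr := nilpotent_pcore_Hall r nilR.
have r_w : r.-elt w by rewrite /p_elt ow pnat_id ?pdiv_prime.
apply: pgroupS (pcore_pgroup r (nres n k L)); rewrite gen_subG subUset !sub1set.
rewrite !(mem_Hall_pcore hallr) ?p_eltJ ?r_w //.
  by apply: (subsetP (nresS n k sKyL)); rewrite nresJ memJ_conjg.
exact: (subsetP (nresS n k sKL)).
Qed.

(** * Reduction to an element of odd prime order *)

Theorem theorem1p4 (gT : finGroupType) (G : {group gT}) :
  solvable G <->
  (forall g : gT, g \in G ->
   forall b : 'I_8 -> gT, (forall i, b i \in G) ->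
   solvable <<[set g ^ (b i)^-1 | i : 'I_8]>>).
Proof.
split=> [solG g Gg b Gb | ].
  apply: solvableS solG; rewrite gen_subG; apply/subsetP=> _ /imsetP[i _ ->].
  by rewrite groupJ ?groupV.
have [m] := ubnP #|G|; elim: m gT G => // m IH gT G leGm sol8.
have [/existsP[N /and3P[nsNG solN ntN]] | nN] :=
  boolP [exists N : {group gT}, [&& N <| G, solvable N & N != 1 :> {set gT}]].
  rewrite (series_sol nsNG) solN; have [sNG nNG] := andP nsNG.
  apply: IH => [|_ /morphimP[g Ng Gg ->] b Gb].
    exact: leq_trans (ltn_quotient ntN sNG) leGm.
  have /fin_all_exists2[c Gc defb] i : exists2 c, c \in G & coset N c = b i.
    by have /morphimP[c Nc Gc ->] := Gb i; exists c.
  have sAG : [set g ^ (c i)^-1 | i : 'I_8] \subset G.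
    by apply/subsetP=> _ /imsetP[i _ ->]; rewrite groupJ ?groupV.
  have := quotient_sol N (sol8 g Gg c Gc).
  rewrite /= quotient_gen ?(subset_trans sAG) //.
  rewrite /quotient morphimEsub ?(subset_trans sAG) // -imset_comp.
  congr (is_true (solvable <<_>>)); apply: eq_imset => i /=.
  have Nc := subsetP nNG _ (Gc i).
  by rewrite morphJ ?groupV // morphV //= defb.
(* Now [G] has no nontrivial solvable normal subgroup. Unless [G] is a 2-group, an odd prime divides
   its order, and the resulting nontrivial ['O_r(G)] is a contradiction. *)
have [pG | ] := boolP (2.-group G); first exact: pgroup_sol pG.
move=> n2G; have p2_gt1 : 1 < #|G|`_2^'.
  rewrite ltn_neqAle part_gt0 andbT eq_sym.
  by apply: contra n2G; rewrite partG_eq1 /pgroup pnatNK.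
set p := pdiv #|G|`_2^'; have pr_p : prime p by apply: pdiv_prime.
have dvpG : p %| #|G| := dvdn_trans (pdiv_dvd _) (dvdn_part _ _).
have p_gt2 : 2 < p.
  rewrite ltn_neqAle prime_gt1 // andbT eq_sym.
  by apply: (pnatPpi (part_pnat 2^' #|G|)); rewrite pi_pdiv.
have [x Gx ox] := Cauchy pr_p dvpG.
have [|r ntO] := Fitting_neq1_conj8 pr_p p_gt2 ox Gx.
  move=> g Sg; have /fin_all_exists2[c Gc defg] i : exists2 c, c \in G & g i = x ^ c^-1.
    by have /imsetP[c Gc ->] := Sg i; exists c^-1; rewrite ?groupV ?invgK.
  have -> : [set g i | i : 'I_8] = [set x ^ (c i)^-1 | i : 'I_8] by apply: eq_imset.
  exact: sol8.
have /existsPn/(_ 'O_r(G)%G) := nN; rewrite pcore_normal ntO andbT /= => /negP[].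
exact: pgroup_sol (pcore_pgroup r G).
Qed.
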